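(* Let $f,a\in L^\infty(Y\times(0,T))$ and $b\in L^\infty(Y\times Y\times(0,T))$ be such that $(f,a,b)$ is a trajectory of the forward problem $\partial_tf=\sigma(a-B_bf)$. Let $\sigma'$ be bounded above on $\mathbb{R}$ and bounded below away from $0$ uniformly on bounded sets of $\mathbb{R}$. Then the linearized problem $$\partial_tg=-\sigma'(\xi_{a,b})\,B_bg+\sigma'(\xi_{a,b})\,(\alpha-B_\beta f),\qquad \xi_{a,b}:=a-B_bf,$$ with state $g(\cdot,t)\in L^2(Y)$ and controls $(\alpha,\beta)=(\alpha(y,t),\beta(y,z,t))$ is controllable on $[0,T]$.
   Context: $Y\subseteq\mathbb{R}^d$ is bounded and open, $0<T<\infty$, $\sigma:\mathbb{R}\to\mathbb{R}$ is continuously differentiable. For a kernel $b=b(y,z,t)$, $(B_b\varphi)(y,t)=\int_Yb(y,z,t)\varphi(z,t)\,dz$. ''Bounded below away from $0$ uniformly on bounded sets'' means $\inf_{|x|\le R}\sigma'(x)>0$ for every $R>0$. ''Controllable'' means exactly controllable in $L^2(Y)$: for all $g_I,g_T\in L^2(Y)$ there exist controls $\alpha\in L^2((0,T);L^2(Y))$, $\beta\in L^2((0,T);L^2(Y\times Y))$ such that the solution $g\in C([0,T];L^2(Y))$ of the linearized problem with $g(\cdot,0)=g_I$ satisfies $g(\cdot,T)=g_T$. *)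

(* Defs.v *)
From HB Require Import structures.
From mathcomp Require Import all_boot all_order all_algebra.
From mathcomp Require Import all_classical all_reals all_analysis.
From mathcomp Require Import measurable_realfun.

Set Implicit Arguments.
Unset Strict Implicit.
Unset Printing Implicit Defensive.

Import Order.TTheory GRing.Theory Num.Def Num.Theory.
Import numFieldNormedType.Exports.

Local Open Scope classical_set_scope.
Local Open Scope ring_scope.

(* Borel sigma-algebra of ['rV[R]_d], whose topology and bounded sets (for the
   library's sup norm) are the usual ones of R^d. *)

Definition rV_borel_display : measure_display.
Proof. exact: default_measure_display. Qed.

Section rV_borel.
Context (R : realType) (d : nat).

Let borel : set (set 'rV[R]_d) := <<s [set U : set 'rV[R]_d | open U] >>.

Let borel0 : borel set0.
Proof. exact: sigma_algebra0. Qed.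

Let borelC A : borel A -> borel (~` A).
Proof. exact: sigma_algebraC. Qed.

Let borel_bigcup (F : (set 'rV[R]_d)^nat) :
  (forall i, borel (F i)) -> borel (\bigcup_i F i).
Proof. exact: sigma_algebra_bigcup. Qed.

HB.instance Definition _ := @isMeasurable.Build rV_borel_display
  'rV[R]_d borel borel0 borelC borel_bigcup.

Lemma rV_open_measurable (U : set 'rV[R]_d) : open U -> measurable U.
Proof. by move=> oU; exact: sub_sigma_algebra. Qed.

Lemma measurable_rV_coord (i : 'I_d) :
  measurable_fun [set: 'rV[R]_d] (fun v : 'rV[R]_d => v ord0 i).
Proof.
apply: (measurability _ (RGenOpens.measurableE R)).
move=> _ [_ [a [b ->]] <-].
rewrite setTI; apply: rV_open_measurable; apply: open_comp.
- by move=> v _; exact: coord_continuous.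
- exact: interval_open.
Qed.

End rV_borel.

Section rV_coord.
Context (R : realType).

Lemma rV_open_bigcup n (U : set 'rV[R]_n) : open U ->
  U = \bigcup_(k in [set k : 'rV[rat]_n * nat |
        ball (map_mx (@ratr R) k.1) (k.2.+1%:R^-1) `<=` U])
      ball (map_mx (@ratr R) k.1) (k.2.+1%:R^-1).
Proof.
move=> oU; apply/seteqP; split=> [v Uv|v [k /= kU]]; last exact: kU.
have /nbhs_ballP[e /= e0 eU] : nbhs v U by exact: open_nbhs_nbhs.
have [m me] : exists m : nat, m.+1%:R^-1 + m.+1%:R^-1 < e.
  have e20 : 0 < e / 2 by rewrite divr_gt0.
  have [m _ /(_ m (leqnn m)) /= hm] := near_infty_natSinv_lt (PosNum e20).
  by exists m; rewrite [ltRHS]splitr ltrD.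
set r : R := m.+1%:R^-1 in me.
have r0 : 0 < r by rewrite invr_gt0.
have Q j : exists q : rat, `|v ord0 j - ratr q| < r.
  have /rat_in_itvoo[q] : v ord0 j - r < v ord0 j + r by rewrite ltrD2l gtrN.
  by rewrite in_itv/= => /andP[h1 h2]; exists q; rewrite ltr_distlC h1.
have /choice[q qP] := Q.
exists (\row_j q j, m) => /=.
  move=> w [_ hw]; apply: eU; split => // i j; rewrite ord1 /ball/=.
  rewrite -(subrKA (ratr (q j))) (le_lt_trans (ler_normD _ _))//.
  rewrite (lt_trans _ me)// ltrD//.
  by have := hw ord0 j; rewrite /ball/= !mxE.
split => // i j; rewrite ord1 /ball/= !mxE distrC; exact: qP.
Qed.

Lemma measurable_fun_rVP d (T : measurableType d) n (f : T -> 'rV[R]_n) :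
  (forall i, measurable_fun [set: T] (fun x => f x ord0 i)) ->
  measurable_fun [set: T] f.
Proof.
move=> mf; apply: (@measurability _ _ _ _ _ f
  [set U : set 'rV[R]_n | open U]) => // _ [U oU <-].
rewrite setTI (rV_open_bigcup oU) preimage_bigcup bigcup_mkcond.
apply: countable_bigcupT_measurable => [|[q k]]; first exact: countableP.
case: ifPn => // _ /=.
rewrite [X in measurable X](_ : _ = \bigcap_(i in [set: 'I_n])
    (fun x => f x ord0 i) @^-1` ball (ratr (q ord0 i) : R) k.+1%:R^-1).
  apply: fin_bigcap_measurable => // i _; rewrite -[X in measurable X]setTI.
  by apply: mf => //; apply: open_measurable; exact: ball_open.
apply/seteqP; split=> [x [_ xq] i _|x xq].
  by have := xq ord0 i; rewrite mxE.
split=> [|i j]; first by rewrite invr_gt0.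
by rewrite ord1 mxE; exact: xq.
Qed.

End rV_coord.


(* The canonical structures of the library only find this for products of
   subprobabilities. *)
Lemma product_sigma_finite d1 d2 (T1 : measurableType d1)
    (T2 : measurableType d2) (R : realType)
    (m1 : {sigma_finite_measure set T1 -> \bar R})
    (m2 : {sigma_finite_measure set T2 -> \bar R}) :
  sigma_finite setT (m1 \x m2)%E.
Proof.
have /sigma_finiteP[F [TF ndF Foo]] := sigma_finiteT m1.
have /sigma_finiteP[G [TG ndG Goo]] := sigma_finiteT m2.
exists (fun n => F n `*` G n).
  rewrite -setXTT TF TG predeqE => -[x y]; split.
    move=> [/= [n _ Fnx] [k _ Gky]]; exists (maxn n k) => //; split.
    - by move: x Fnx; exact/subsetPset/ndF/leq_maxl.
    - by move: y Gky; exact/subsetPset/ndG/leq_maxr.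
  by move=> [n _ []/= ? ?]; split; exists n.
move=> k; have [? ?] := Foo k; have [? ?] := Goo k.
split; first exact: measurableX.
by rewrite product_measure1E// lte_mul_pinfty// ge0_fin_numE.
Qed.

(* Lebesgue measure on R^d, built by induction on d: dirac mass on the one-point
   space R^0, and on R^(n+1) the image of the product of the Lebesgue measures
   of R and R^n under (x, v) |-> (x, v_0, ..., v_(n-1)). *)

Section rV_cons.
Context (R : realType) (n : nat).

Definition rV_cons (p : measurableTypeR R * 'rV[R]_n) : 'rV[R]_n.+1 :=
  \row_j oapp (p.2 ord0) p.1 (unlift ord0 j).

Definition rV_uncons (v : 'rV[R]_n.+1) : measurableTypeR R * 'rV[R]_n :=
  (v ord0 ord0, \row_j v ord0 (lift ord0 j)).

Lemma rV_consK : cancel rV_cons rV_uncons.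
Proof.
move=> [x v]; rewrite /rV_uncons mxE unlift_none/=; congr (_, _).
by apply/rowP => j; rewrite !mxE liftK.
Qed.

Lemma rV_unconsK : cancel rV_uncons rV_cons.
Proof.
by move=> v; apply/rowP => j; rewrite mxE; case: unliftP => [k|] ->/=; rewrite ?mxE.
Qed.

Let measurable_rV_cons : measurable_fun [set: _] rV_cons.
Proof.
apply: measurable_fun_rVP => i; case: (unliftP ord0 i) => [k|] ->.
- under eq_fun do rewrite mxE liftK /=.
  exact: (measurableT_comp (measurable_rV_coord k) measurable_snd).
- under eq_fun do rewrite mxE unlift_none /=.
  exact: measurable_fst.
Qed.

HB.instance Definition _ := isMeasurableFun.Build _ _ _ _ rV_cons
  measurable_rV_cons.

Lemma measurable_rV_uncons : measurable_fun [set: _] rV_uncons.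
Proof.
apply: measurable_fun_pair; first exact: measurable_rV_coord.
apply: measurable_fun_rVP => i; under eq_fun do rewrite mxE.
exact: measurable_rV_coord.
Qed.

Definition lebesgue_cons (mu : {sigma_finite_measure set 'rV[R]_n -> \bar R})
    : set 'rV[R]_n.+1 -> \bar R :=
  pushforward (lebesgue_measure \x mu)%E rV_cons.

Section instances.
Variable mu : {sigma_finite_measure set 'rV[R]_n -> \bar R}.

Let m0 : lebesgue_cons mu set0 = 0%E.
Proof. exact: measure0. Qed.

Let m_ge0 A : (0 <= lebesgue_cons mu A)%E.
Proof. exact: measure_ge0. Qed.

Let m_additive : semi_sigma_additive (lebesgue_cons mu).
Proof. exact: measure_semi_sigma_additive. Qed.

HB.instance Definition _ := isMeasure.Build _ _ _ (lebesgue_cons mu)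
  m0 m_ge0 m_additive.

Let m_sigma_finite : sigma_finite setT (lebesgue_cons mu).
Proof.
have [F UF mF] := product_sigma_finite lebesgue_measure mu.
exists (fun k => rV_uncons @^-1` F k).
  by rewrite -preimage_bigcup -UF preimage_setT.
move=> k; have [mFk Fk] := mF k; split.
  by rewrite -[X in measurable X]setTI; exact: measurable_rV_uncons.
rewrite /lebesgue_cons /pushforward -comp_preimage.
by rewrite (_ : _ \o _ = id)//; apply/funext => p; exact: rV_consK.
Qed.

HB.instance Definition _ := Measure_isSigmaFinite.Build _ _ _ (lebesgue_cons mu)
  m_sigma_finite.

End instances.
End rV_cons.

Fixpoint lebesgue_rV (R : realType) (d : nat) :
    {sigma_finite_measure set 'rV[R]_d -> \bar R} :=
  match d with
  | 0%N => \d_(0 : 'rV[R]_0)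
  | n.+1 => lebesgue_cons (lebesgue_rV R n)
  end.

Lemma lebesgue_rV_box (R : realType) (d : nat) (l u : 'I_d -> R) :
  (forall i, l i <= u i) ->
  lebesgue_rV R d [set v : 'rV[R]_d | forall i, v ord0 i \in `]l i, u i[] =
  (\prod_(i < d) (u i - l i))%:E.
Proof.
elim: d l u => [|n ih] l u lu.
  by rewrite big_ord0 /= diracE mem_set// => -[].
rewrite big_ord_recl EFinM -(ih (fun i => l (lift ord0 i))); last by move=> i.
rewrite [LHS](_ : _ = (lebesgue_measure \x lebesgue_rV R n)%E
    (`]l ord0, u ord0[%classic `*` [set v : 'rV[R]_n |
      forall i, v ord0 i \in `]l (lift ord0 i), u (lift ord0 i)[])).
  rewrite product_measure1E//; last first.
    rewrite [X in measurable X](_ : _ = \bigcap_(i in [set: 'I_n])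
        (fun v : 'rV[R]_n => v ord0 i) @^-1`
        `]l (lift ord0 i), u (lift ord0 i)[%classic).
      apply: fin_bigcap_measurable => // i _; rewrite -[X in measurable X]setTI.
      exact: measurable_rV_coord.
    by apply/seteqP; split=> [v vi i _|v vi i]; [exact: vi|exact: (vi i)].
  congr (_ * _)%E; rewrite [LHS]lebesgue_measure_itv/= lte_fin.
  have := lu ord0; rewrite le_eqVlt => /predU1P[->|->//].
  by rewrite ltxx subrr.
rewrite /lebesgue_rV /= /lebesgue_cons /pushforward; congr (_ _).
apply/funext => -[x v]; apply/propext; split=> /= [h|].
  split=> [|i]; first by have := h ord0; rewrite mxE unlift_none.
  by have := h (lift ord0 i); rewrite mxE liftK.
move=> [hx hv] i.
by case: (unliftP ord0 i) => [k|] ->; rewrite mxE ?liftK ?unlift_none/=.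
Qed.

(* [u \_ D] is the extension of u by zero outside D. *)
Definition Lp_on d (X : measurableType d) (R : realType)
    (mu : {measure set X -> \bar R}) (D : set X) (p : \bar R) (u : X -> R) :
    Prop :=
  u \_ D \in Lfun mu p.

Section neural_field.
Context (R : realType) (d : nat) (Y : set 'rV[R]_d) (T : R).

(* Functions of (y, t) and kernels depending on (y, z, t) are curried; they are
   concrete representatives of their classes modulo equality almost everywhere. *)
Local Notation state := ('rV[R]_d -> R -> R).
Local Notation kernel := ('rV[R]_d -> 'rV[R]_d -> R -> R).
Local Notation lebY := (lebesgue_rV R d).
Local Notation lebT := (@lebesgue_measure R).

Definition Lp_space (p : \bar R) (u : 'rV[R]_d -> R) : Prop :=
  Lp_on lebY Y p u.

Definition Lp_space_time (p : \bar R) (u : state) : Prop :=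
  Lp_on (lebY \x lebT)%E (Y `*` `]0, T[%classic) p (fun x => u x.1 x.2).

Definition Lp_kernel (p : \bar R) (b : kernel) : Prop :=
  Lp_on ((lebY \x lebY) \x lebT)%E ((Y `*` Y) `*` `]0, T[%classic) p
    (fun x => b x.1.1 x.1.2 x.2).

(* (B_b phi)(y, t) *)
Definition kernel_op (b : kernel) (phi : state) : state :=
  fun y t => \int[lebY]_(z in Y) (b y z t * phi z t).

Definition xi (a : state) (b : kernel) (f : state) : state :=
  fun y t => a y t - kernel_op b f y t.

(* d_t f = sigma (a - B_b f) in integrated form; since f is only a class in
   L^oo(Y x (0, T)), the identity is required almost everywhere in (y, t), for
   some initial datum f0. *)
Definition forward_trajectory (sigma : R -> R) (f a : state) (b : kernel) :
    Prop :=
  exists2 f0 : 'rV[R]_d -> R, Lp_space +oo%E f0 &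
    {ae (lebY \x lebT)%E, forall x, (Y `*` `]0, T[%classic) x ->
      f x.1 x.2 =
      f0 x.1 + \int[lebT]_(s in `]0, x.2[) sigma (xi a b f x.1 s)}.

Definition linearized_rhs (sigma : R -> R) (f a : state) (b : kernel)
    (alpha : state) (beta : kernel) (g : state) : state :=
  fun y t =>
    - derive1 sigma (xi a b f y t) * kernel_op b g y t +
    derive1 sigma (xi a b f y t) * (alpha y t - kernel_op beta f y t).

(* g in C([0, T]; L^2(Y)), through a representative that is jointly measurable
   in (y, t) (every class has one). *)
Definition continuous_L2 (g : state) : Prop :=
  [/\ measurable_fun (Y `*` `[0, T]%classic)
        (fun x : 'rV[R]_d * measurableTypeR R => g x.1 x.2),
      forall t, t \in `[0, T] -> Lp_space 2%:E (g ^~ t) &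
      forall t, t \in `[0, T] ->
        Lnorm lebY 2%:E (EFin \o ((fun y => g y s - g y t) \_ Y))
          @[s --> within `[0, T]%classic (nbhs t)] --> 0%E].

(* Solutions of the linearized problem with g(., 0) = gI, in integrated form:
   the identity g(t) = g(0) + int_0^t rhs(s) ds holds in L^2(Y) for all t. *)
Definition linearized_solution (sigma : R -> R) (f a : state) (b : kernel)
    (alpha : state) (beta : kernel) (gI : 'rV[R]_d -> R) (g : state) : Prop :=
  [/\ continuous_L2 g,
      {ae lebY, forall y, Y y -> g y 0 = gI y} &
      forall t, t \in `[0, T] -> {ae lebY, forall y, Y y ->
        g y t = g y 0 + \int[lebT]_(s in `]0, t[)
          linearized_rhs sigma f a b alpha beta g y s}].

(* "The solution" is rendered as: a solution exists, and every solution reaches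
   gT at time T. *)
Definition linearized_controllable (sigma : R -> R) (f a : state)
    (b : kernel) : Prop :=
  forall gI gT : 'rV[R]_d -> R, Lp_space 2%:E gI -> Lp_space 2%:E gT ->
  exists (alpha : state) (beta : kernel),
    [/\ Lp_space_time 2%:E alpha, Lp_kernel 2%:E beta,
        exists g, linearized_solution sigma f a b alpha beta gI g &
        forall g, linearized_solution sigma f a b alpha beta gI g ->
          {ae lebY, forall y, Y y -> g y T = gT y}].

End neural_field.

(* Main.v *)
Require Import Defs.
From HB Require Import structures.
From mathcomp Require Import all_boot all_order all_algebra.
From mathcomp Require Import all_classical all_reals all_analysis.
From mathcomp Require Import measurable_realfun ess_sup_inf.
From mathcomp Require Import ring lra.

Set Implicit Arguments.
Unset Strict Implicit.
Unset Printing Implicit Defensive.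

Import Order.TTheory GRing.Theory Num.Def Num.Theory.
Import numFieldNormedType.Exports.

Local Open Scope classical_set_scope.
Local Open Scope ring_scope.

(** Only the control alpha is needed: beta is taken to be 0. Let gbar be the
    affine path in L^2(Y) from gI at time 0 to gT at time T. Choosing
      alpha = B_b gbar + (gT - gI) / (T sigma' (xi))
    makes the right-hand side of the linearized equation along gbar equal to
    (gT - gI) / T everywhere, so gbar is a solution and it ends at gT
    ([interpolation_solution]). The control is of class L^2
    ([steering_control_Lp]): a, b and f are essentially bounded and Y has finite
    measure, so xi is essentially bounded, hence sigma' (xi) is bounded away
    from 0 almost everywhere; moreover B_b gbar is essentially bounded.

    It remains to see that every solution g reaches gT, which is a uniqueness
    statement ([solution_reaches_target]). The gap h = g - gbar satisfies, for
    almost every y, h(y, t) = - \int_0^t sigma' (xi) (B_b h)(y, s) ds. The upper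
    bound on sigma' and the essential bound on b give, for the L^1(Y) norm m of
    h, the inequality m(t) <= L \int_0^t m, used for exponential majorants of m
    ([linearized_rhs_gap], [solution_gap_gronwall]). Working in L^1 rather than L^2 is possible because
    Y has finite measure. As g and gbar are continuous in L^2(Y) on the compact
    [0, T], m is bounded ([solution_gap_bounded]), and a Gronwall argument with
    exponential weights yields m = 0 ([exp_weight_gronwall]).

    All functions being concrete representatives, the bound on B_b requires that
    b(y, ., t) be essentially bounded for almost every (y, t), while b is given
    as essentially bounded on Y x Y x (0, T); [ae_product_middle] performs this
    exchange of null sets. *)

(** * Null sets of product measures *)

Section product_ae.
Context d1 d2 (X : measurableType d1) (Z : measurableType d2) (R : realType).
Variables (m1 : {sigma_finite_measure set X -> \bar R}).
Variables (m2 : {sigma_finite_measure set Z -> \bar R}).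
Local Open Scope ereal_scope.

Lemma product_measure1_eq0 (N : set (X * Z)) : measurable N ->
  (m1 \x m2) N = 0 <-> {ae m1, forall x, m2 (xsection N x) = 0}.
Proof.
move=> mN; have mF := measurable_fun_xsection m2 mN.
have -> : (m1 \x m2) N = \int[m1]_x `|(m2 \o xsection N) x|.
  by apply: eq_integral => x _; rewrite gee0_abs.
rewrite (ae_eq_integral_abs m1 measurableT mF).
by split; apply: filterS => x //=; apply.
Qed.

Lemma product_measure1_ysection (N : set (X * Z)) : measurable N ->
  (m1 \x m2) N = \int[m2]_y m1 (ysection N y).
Proof.
move=> mN; rewrite /product_measure1 -[LHS]/(\int[m1]_x _).
rewrite -(indic_fubini_tonelli_FE m2 mN) indic_fubini_tonelli//.
by rewrite (indic_fubini_tonelli_GE m1 mN).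
Qed.

Lemma product_measure1_eq0_ysection (N : set (X * Z)) : measurable N ->
  (m1 \x m2) N = 0 -> {ae m2, forall y, m1 (ysection N y) = 0}.
Proof.
move=> mN; rewrite product_measure1_ysection//.
have mG := measurable_fun_ysection m1 mN.
have -> : \int[m2]_y m1 (ysection N y) =
    \int[m2]_x `|(m1 \o ysection N) x|.
  by apply: eq_integral => x _; rewrite gee0_abs.
move/(ae_eq_integral_abs m2 measurableT mG).
by apply: filterS => x //=; apply.
Qed.

Lemma ae_product1 (P : X * Z -> Prop) : {ae m1 \x m2, forall p, P p} ->
  {ae m1, forall x, {ae m2, forall z, P (x, z)}}.
Proof.
move=> [N [mN N0 PN]]; have := (product_measure1_eq0 mN).1 N0.
apply: filterS => x Nx0; exists (xsection N x); split => //.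
  exact: measurable_xsection.
by move=> z /= nP; rewrite /xsection/= inE; apply: PN.
Qed.

Lemma ae_product2 (P : X * Z -> Prop) : {ae m1 \x m2, forall p, P p} ->
  {ae m2, forall z, {ae m1, forall x, P (x, z)}}.
Proof.
move=> [N [mN N0 PN]]; have := product_measure1_eq0_ysection mN N0.
apply: filterS => z Nz0; exists (ysection N z); split => //.
  exact: measurable_ysection.
by move=> x /= nP; rewrite /ysection/= inE; apply: PN.
Qed.

End product_ae.

Section product_ae3.
Context d1 d2 d3 (X : measurableType d1) (Z : measurableType d2)
  (S : measurableType d3) (R : realType).
Variables (m1 : {sigma_finite_measure set X -> \bar R}).
Variables (m2 : {sigma_finite_measure set Z -> \bar R}).
Variables (m3 : {sigma_finite_measure set S -> \bar R}).
Local Open Scope ereal_scope.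

(** A property that holds for almost every (x, z, s) holds, for almost every
    (x, s), for almost every z. The product measures are nested in a different
    order on the two sides. *)
Lemma ae_product_middle (P : X -> Z -> S -> Prop) :
  {ae (m1 \x m2) \x m3, forall p, P p.1.1 p.1.2 p.2} ->
  {ae m1 \x m3, forall q, {ae m2, forall z, P q.1 z q.2}}.
Proof.
move=> [N [mN N0 PN]].
pose r (p : (X * S) * Z) : (X * Z) * S := ((p.1.1, p.2), p.1.2).
have mr : measurable_fun setT r.
  apply: measurable_fun_pair; last first.
    exact: (measurableT_comp measurable_snd measurable_fst).
  apply: measurable_fun_pair; last exact: measurable_snd.
  exact: (measurableT_comp measurable_fst measurable_fst).
have mN' : measurable (r @^-1` N).
  by rewrite -[X in measurable X]setTI; exact: mr.
(* E collects the (x, s) over which the null set N has a non-null z-section. *)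
pose E : set (X * S) := [set q | m2 (xsection (r @^-1` N) q) != 0].
have mE : measurable E.
  have mF := measurable_fun_xsection m2 mN'.
  have -> : E = setT `&` (m2 \o xsection (r @^-1` N)) @^-1` (~` [set 0]).
    rewrite setTI; apply/seteqP; split => q /=.
      by move=> /eqP.
    by move=> /eqP.
  by apply: mF => //; apply: measurableC; exact: emeasurable_set1.
exists E; split => //.
  apply: (product_measure1_eq0 m1 m3 mE).2.
  have N1 : {ae m1 \x m2, forall p, m3 (xsection N p) = 0}.
    have mF := measurable_fun_xsection m3 mN.
    move: N0; have -> : ((m1 \x m2) \x m3) N =
        \int[(m1 \x m2)]_x `|(m3 \o xsection N) x|.
      by apply: eq_integral => x _; rewrite gee0_abs.
    move/(ae_eq_integral_abs (m1 \x m2) measurableT mF).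
    by apply: filterS => x //=; apply.
  have := ae_product1 N1; apply: filterS => x Nx.
  pose Nx' : set (Z * S) := [set w | N ((x, w.1), w.2)].
  have mNx' : measurable Nx'.
    have mj : measurable_fun setT (fun w : Z * S => ((x, w.1), w.2)).
      apply: measurable_fun_pair; last exact: measurable_snd.
      apply: measurable_fun_pair; last exact: measurable_fst.
      exact: measurable_cst.
    by rewrite -[X in measurable X]setTI; exact: mj.
  have Nx'0 : (m2 \x m3) Nx' = 0.
    apply: (product_measure1_eq0 m2 m3 mNx').2; apply: filterS Nx => z.
    by rewrite (_ : xsection Nx' z = xsection N (x, z)).
  have [M [mM M0 HM]] := product_measure1_eq0_ysection mNx' Nx'0.
  apply: (@subset_measure0 _ _ _ _ _ M) => //; first exact: measurable_xsection.
  move=> t; rewrite /xsection/= inE /E/= => /eqP tE; apply: HM => /= tM.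
  apply: tE; rewrite -tM (_ : xsection _ _ = ysection Nx' t)//.
move=> q /= nP; rewrite /E/=; apply/eqP => q0; apply: nP.
exists (xsection (r @^-1` N) q); split => //; first exact: measurable_xsection.
by move=> z /= nP; rewrite /xsection/= inE; exact: PN.
Qed.

End product_ae3.

Section parametric_measurability.
Context d1 d2 (X : measurableType d1) (Z : measurableType d2) (R : realType).
Variable m : {sigma_finite_measure set Z -> \bar R}.

Lemma measurable_fun_Rintegral (F : X * Z -> R) : measurable_fun setT F ->
  measurable_fun setT (fun x => \int[m]_z F (x, z)).
Proof.
move=> mF; apply: (measurableT_comp (fine_measurable measurableT)).
have mF' : measurable_fun setT (EFin \o F) by exact/measurable_EFinP.
have -> : (fun x => \int[m]_z (F (x, z))%:E)%E =
   (fun x => fubini_F m (EFin \o F)^\+ x - fubini_F m (EFin \o F)^\- x)%E.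
  apply/funext => x; rewrite [LHS]integralE.
  by congr (_ - _)%E; apply: eq_integral => z _; rewrite ?(funeposE, funenegE).
apply: emeasurable_funB.
- by apply: measurable_fun_fubini_tonelli_F => //; exact: measurable_funepos.
- by apply: measurable_fun_fubini_tonelli_F => //; exact: measurable_funeneg.
Qed.

End parametric_measurability.

(** * Functions of class L^p on a measurable set *)

Section Lp_on_theory.
Context d (X : measurableType d) (R : realType).
Variables (mu : {measure set X -> \bar R}) (D : set X).
Hypothesis mD : measurable D.
Implicit Types u v : X -> R.

Lemma integrable_le_ae u v : measurable_fun D u ->
  {ae mu, forall x, D x -> `|u x| <= v x} ->
  mu.-integrable D (EFin \o v) -> mu.-integrable D (EFin \o u).
Proof.
move=> mfu uv /integrableP[mv voo]; apply/integrableP; split.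
  exact/measurable_EFinP.
apply: le_lt_trans voo; apply: ae_ge0_le_integral => //.
- by apply: measurableT_comp => //; exact/measurable_EFinP.
- exact: measurableT_comp.
- apply: filterS uv => x /[apply] h; rewrite lee_fin.
  by rewrite (le_trans h)// ler_norm.
Qed.

Lemma normr_Rintegral_le_ae u v : measurable_fun D u ->
  (forall x, D x -> 0 <= v x) -> {ae mu, forall x, D x -> `|u x| <= v x} ->
  mu.-integrable D (EFin \o v) ->
  `|\int[mu]_(x in D) u x| <= \int[mu]_(x in D) v x.
Proof.
move=> mfu v0 uv iv; have iu := integrable_le_ae mfu uv iv.
rewrite -lee_fin EFin_normr_Rintegral// /Rintegral fineK; last first.
  exact: integrable_fin_num.
have mv : measurable_fun D (EFin \o v) by exact: (measurable_int mu).
have mfu' : measurable_fun D (EFin \o u) by exact/measurable_EFinP.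
apply: le_trans (le_abse_integral mu mD mfu') _.
apply: ae_ge0_le_integral => //; exact: measurableT_comp.
Qed.

Lemma Lp_on_pinftyP u : Lp_on mu D +oo%E u -> measurable_fun D u /\
  exists2 M, 0 <= M & {ae mu, forall x, D x -> `|u x| <= M}.
Proof.
rewrite /Lp_on => /andP[]; rewrite !inE/= => mfu uoo; split.
  exact/measurable_restrictT.
(* When mu vanishes, the L^oo norm is 0 by convention and says nothing of u. *)
have [mu0|] := ltP 0%E (mu setT); last first.
  move=> mu0; exists 0 => //; exists setT; split => //.
  by apply/eqP; rewrite eq_le mu0 measure_ge0.
move: uoo; rewrite /finite_norm unlock mu0.
move=> /ess_supr_bounded[M uM]; exists `|M| => //.
apply: filterS uM => x /= + Dx; rewrite patchE mem_set// => h.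
by rewrite (le_trans h)// ler_norm.
Qed.

Lemma Lp_on_2P u : Lp_on mu D 2%:E u <->
  measurable_fun D u /\ mu.-integrable D (EFin \o (fun x => u x ^+ 2)).
Proof.
have E : (EFin \o (fun x => u x ^+ 2)) \_ D =
    EFin \o (fun x => (u \_ D) x ^+ 2).
  apply/funext => x; rewrite /= !patchE; case: ifPn => // _.
  by rewrite expr0n.
split=> [uL|[mfu u2]].
  split.
    move: uL => /andP[]; rewrite !inE/= => + _.
    exact: (measurable_restrictT _ mD).2.
  by apply/integrable_mkcond => //; rewrite E; exact: Lfun2_integrable_sqr.
apply/andP; rewrite !inE/=; split; first exact: (measurable_restrictT _ mD).1.
rewrite /finite_norm unlock poweR_lty//.
move/integrable_mkcond : u2 => /(_ mD); rewrite E => /integrableP[_].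
apply: le_lt_trans; rewrite le_eqVlt; apply/orP; left; apply/eqP.
apply: eq_integral => x _ /=; congr EFin.
by rewrite powR_mulrn// real_normK ?num_real// ger0_norm// sqr_ge0.
Qed.

Lemma Lp_on_2_lin (a b : R) u v : Lp_on mu D 2%:E u -> Lp_on mu D 2%:E v ->
  Lp_on mu D 2%:E (fun x => a * u x + b * v x).
Proof.
move=> /Lp_on_2P[mfu iu] /Lp_on_2P[mv iv]; apply/Lp_on_2P; split.
  by apply: measurable_funD; apply: measurable_funM.
apply: (@integrable_le_ae _
    (fun x => 2 * a ^+ 2 * u x ^+ 2 + 2 * b ^+ 2 * v x ^+ 2)).
- by apply: measurable_funX; apply: measurable_funD; apply: measurable_funM.
- apply: aeW => x _; rewrite ger0_norm ?sqr_ge0//.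
  rewrite -subr_ge0 (_ : _ - _ = (a * u x - b * v x) ^+ 2) ?sqr_ge0//; ring.
- exact: (integrableD mD (integrableZl mD (2 * a ^+ 2) iu)
    (integrableZl mD (2 * b ^+ 2) iv)).
Qed.

Hypothesis Dfin : (mu D < +oo)%E.

Lemma integrable_cst_on (c : R) : mu.-integrable D (EFin \o cst c).
Proof.
apply: measurable_bounded_integrable => //.
by exists `|c|; split; rewrite ?num_real// => x cx y Dy /=; exact: ltW.
Qed.

Lemma Lp_on_2_integrable u : Lp_on mu D 2%:E u -> mu.-integrable D (EFin \o u).
Proof.
move=> /Lp_on_2P[mfu iu].
apply: (@integrable_le_ae _ (fun x => 1 + u x ^+ 2)) => //.
- apply: aeW => x _; rewrite -real_normK ?num_real//.
  by have := sqr_ge0 (`|u x| - 2^-1); lra.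
- exact: (integrableD mD (integrable_cst_on 1) iu).
Qed.

Lemma Lp_on_2_le_ae u v (c : R) : measurable_fun D u ->
  {ae mu, forall x, D x -> `|u x| <= c + v x} ->
  mu.-integrable D (EFin \o (fun x => v x ^+ 2)) -> Lp_on mu D 2%:E u.
Proof.
move=> mfu uv iv; apply/Lp_on_2P; split => //.
apply: (@integrable_le_ae _ (fun x => 2 * c ^+ 2 + 2 * v x ^+ 2)).
- exact: measurable_funX.
- apply: filterS uv => x /[apply] h; rewrite ger0_norm ?sqr_ge0//.
  rewrite -real_normK ?num_real// (@le_trans _ _ ((c + v x) ^+ 2))//.
    by rewrite lerXn2r// nnegrE (le_trans _ h).
  by have := sqr_ge0 (c - v x); lra.
- exact: (integrableD mD (integrable_cst_on (2 * c ^+ 2))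
    (integrableZl mD 2 iv)).
Qed.

(** On a set of finite measure, a function of L^2 norm at most 1 has an L^1 norm
    bounded by a constant, because |u| <= 1 + u^2. *)
Lemma Lnorm2_le1 u : measurable_fun D u ->
  (Lnorm mu 2%:E (EFin \o (u \_ D)) <= 1)%E ->
  mu.-integrable D (EFin \o u) /\
  (\int[mu]_(x in D) `|u x|%:E <= mu D + 1)%E.
Proof.
move=> mfu N1.
have uL : Lp_on mu D 2%:E u.
  apply/andP; rewrite !inE/=; split; first exact: (measurable_restrictT _ mD).1.
  by rewrite /finite_norm (le_lt_trans N1)// ltry.
have iu := Lp_on_2_integrable uL; split => //.
have [_ iu2] := (Lp_on_2P u).1 uL.
have mu2 : measurable_fun D (fun x => (u x ^+ 2)%:E).
  exact/measurable_EFinP/measurable_funX.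
apply: (@le_trans _ _ (\int[mu]_(x in D) (1 + (u x ^+ 2)%:E))%E).
  apply: ge0_le_integral => //.
  - by apply/measurable_EFinP; exact: measurableT_comp.
  - exact: emeasurable_funD.
  - move=> x _; rewrite -EFinD lee_fin -[in leRHS]real_normK ?num_real//.
    by have := sqr_ge0 (`|u x| - 2^-1); lra.
rewrite ge0_integralD//; last by move=> x _; rewrite lee_fin sqr_ge0.
rewrite integral_cst// mul1e leeD2l//.
have : (Lnorm mu 2%:E (EFin \o (u \_ D)) `^ 2 <= 1)%E.
  have <- : (1 `^ 2 = 1 :> \bar R)%E by rewrite poweR_EFin powR1.
  apply: gt0_ler_poweR => //; rewrite in_itv/= leey ?lee01//.
  by rewrite Lnorm_ge0.
rewrite powR_Lnorm//; apply: le_trans.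
rewrite integral_mkcond le_eqVlt; apply/orP; left; apply/eqP.
apply: eq_integral => x _ /=; rewrite !patchE; case: ifPn => _ /=.
  by rewrite powR_mulrn// real_normK ?num_real.
by rewrite normr0 powR_mulrn// expr0n.
Qed.

End Lp_on_theory.

(** * Bounded integral kernels *)

Section neural_field_prelim.
Context (R : realType) (d : nat) (Y : set 'rV[R]_d) (T : R).
Hypothesis mY : measurable Y.
Local Notation state := ('rV[R]_d -> R -> R).
Local Notation kernel := ('rV[R]_d -> 'rV[R]_d -> R -> R).
Local Notation lebY := (lebesgue_rV R d).
Local Notation lebT := (@lebesgue_measure R).
Local Notation time := (measurableTypeR R).
Local Notation D := (Y `*` `]0, T[%classic : set ('rV[R]_d * time)).
Local Notation D3 :=
  ((Y `*` Y) `*` `]0, T[%classic : set (('rV[R]_d * 'rV[R]_d) * time)).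

Lemma lebesgue_rV_bounded : bounded_set Y -> (lebY Y < +oo)%E.
Proof.
move=> [M [_ YM]]; pose r := `|M| + 1.
have YB : Y `<=`
    [set v : 'rV[R]_d | forall i, v ord0 i \in `]- (r + 1), r + 1[].
  move=> v Yv i.
  have vr : `|v| <= r by apply: YM => //; rewrite /r ltr_pwDr// ler_norm.
  have vi : `|v ord0 i| <= `|v|.
    rewrite [leRHS]mx_normrE.
    exact: (le_bigmax _ (fun ij => `|v ij.1 ij.2|) (ord0, i)).
  by rewrite in_itv/= -ltr_norml (le_lt_trans vi)// (le_lt_trans vr)// ltrDl.
apply: (@le_lt_trans _ _ (lebY
  [set v : 'rV[R]_d | forall i, v ord0 i \in `]- (r + 1), r + 1[])).
  apply: le_measure => //; rewrite ?inE//.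
  rewrite [X in measurable X](_ : _ = \bigcap_(i in [set: 'I_d])
      (fun v : 'rV[R]_d => v ord0 i) @^-1` `]- (r + 1), r + 1[%classic).
    apply: fin_bigcap_measurable => // i _; rewrite -[X in measurable X]setTI.
    exact: measurable_rV_coord.
  by apply/seteqP; split=> [v vi i _|v vi i]; [exact: vi|exact: (vi i)].
rewrite lebesgue_rV_box ?ltry// => i.
have r0 : 0 <= r by rewrite addr_ge0.
lra.
Qed.

Let mD : measurable D. Proof. exact: measurableX. Qed.
Let mD3 : measurable D3.
Proof. by apply: measurableX => //; exact: measurableX. Qed.

Lemma measurable_kernel_op (b : kernel) (phi : state) :
  measurable_fun D3 (fun x => b x.1.1 x.1.2 x.2) ->
  measurable_fun D (fun x => phi x.1 x.2) ->
  measurable_fun D (fun x => kernel_op Y b phi x.1 x.2).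
Proof.
move=> /(measurable_restrictT _ mD3).1 mb /(measurable_restrictT _ mD).1 mphi.
set b' := _ \_ _ in mb; set phi' := _ \_ _ in mphi.
pose F (p : ('rV[R]_d * time) * 'rV[R]_d) : R :=
  b' ((p.1.1, p.2), p.1.2) * phi' (p.2, p.1.2).
have mF : measurable_fun setT F.
  apply: measurable_funM.
    apply: (measurableT_comp mb); apply: measurable_fun_pair.
      apply: measurable_fun_pair; last exact: measurable_snd.
      exact: (measurableT_comp measurable_fst measurable_fst).
    exact: (measurableT_comp measurable_snd measurable_fst).
  apply: (measurableT_comp mphi); apply: measurable_fun_pair.
    exact: measurable_snd.
  exact: (measurableT_comp measurable_snd measurable_fst).
apply: (eq_measurable_fun (fun x => \int[lebY]_z F (x, z))).
  move=> [y t]; rewrite inE => -[/= Yy tT].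
  rewrite /kernel_op [RHS]Rintegral_mkcond; apply: eq_Rintegral => z _.
  rewrite [RHS]patchE /F/= /b' /phi'; case: ifPn => zY; rewrite !patchE.
    have Yz := set_mem zY.
    by rewrite !mem_set.
  rewrite ifF ?mul0r//; apply/negbTE; apply: contra zY.
  by move=> /set_mem[[_ /= Yz] _]; exact: mem_set.
by apply: measurable_funTS; exact: measurable_fun_Rintegral.
Qed.

(** An essentially bounded kernel maps L^1(Y) to L^oo(Y) at almost every time.
    The exceptional null set of (y, t) does not depend on phi, so that the bound
    applies to functions that themselves depend on t. *)
Lemma kernel_op_bound (b : kernel) : Lp_kernel Y T +oo%E b ->
  exists2 M : R, 0 <= M &
  {ae (lebY \x lebT)%E, forall x, D x -> forall phi : 'rV[R]_d -> R,
    lebY.-integrable Y (EFin \o phi) ->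
    lebY.-integrable Y (EFin \o (fun z => b x.1 z x.2 * phi z)) /\
    `|\int[lebY]_(z in Y) (b x.1 z x.2 * phi z)| <=
      M * \int[lebY]_(z in Y) `|phi z|}.
Proof.
move=> /(Lp_on_pinftyP mD3)[mb [M M0 bM]]; exists M => //.
move: bM => /(ae_product_middle
  (P := fun y z t => D3 ((y, z), t) -> `|b y z t| <= M)).
apply: filterS => -[y t] /= bM [/= Yy tT] phi iphi.
have mby : measurable_fun Y (fun z => b y z t).
  have mj : measurable_fun setT (fun z : 'rV[R]_d => ((y, z), t : time)).
    by apply: measurable_fun_pair => //; apply: measurable_fun_pair.
  apply: (eq_measurable_fun (fun z =>
      ((fun x => b x.1.1 x.1.2 x.2) \_ D3) ((y, z), t : time))).
    by move=> z /set_mem Yz; rewrite patchE mem_set.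
  apply: measurable_funTS; apply: measurableT_comp mj.
  exact: (measurable_restrictT _ mD3).1.
have bphi : {ae lebY, forall z, Y z -> `|b y z t * phi z| <= M * `|phi z|}.
  by apply: filterS bM => z h Yz; rewrite normrM ler_wpM2r// h.
have mbphi : measurable_fun Y (fun z => b y z t * phi z).
  apply: measurable_funM => //.
  by have /measurable_EFinP := measurable_int lebY iphi.
have iMphi : lebY.-integrable Y (EFin \o (fun z => M * `|phi z|)).
  exact: (integrableZl mY M (integrable_norm iphi)).
split; first exact: integrable_le_ae bphi iMphi.
rewrite -RintegralZl//; last exact: integrable_norm.
by apply: normr_Rintegral_le_ae => // z _; rewrite mulr_ge0.
Qed.

End neural_field_prelim.

(** * A Gronwall argument with exponential weights *)

Section exponential_gronwall.
Context (R : realType).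
Local Notation lebT := (@lebesgue_measure R).

Lemma fine_lebesgue_itvoo (t : R) : 0 <= t -> fine (lebT `]0%R, t[%classic) = t.
Proof.
move=> t0; transitivity (fine t%:E) => //; congr fine.
rewrite [LHS]lebesgue_measure_itv/= lte_fin.
move: t0; rewrite le_eqVlt => /predU1P[<-|->]; first by rewrite ltxx.
by rewrite oppr0 adde0.
Qed.

Lemma lebesgue_itvoo_lty (t : R) :
  (lebT (`]0%R, t[%classic : set (measurableTypeR R)) < +oo)%E.
Proof.
rewrite [ltLHS]lebesgue_measure_itv/=; case: ifP => // _.
by rewrite -EFinB ltry.
Qed.

Lemma expR_itv_integrable (c t : R) :
  lebT.-integrable `]0, t[ (EFin \o (fun s => expR (c * s))).
Proof.
have ic : lebT.-integrable `[0, t] (EFin \o (fun s => expR (c * s))).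
  apply: continuous_compact_integrable; first exact: segment_compact.
  apply: continuous_subspaceT => x.
  apply: (@continuous_comp _ _ _ (fun s => c * s) expR).
    exact: mulrl_continuous.
  exact: continuous_expR.
apply: integrableS ic => //; exact: subset_itv_oo_cc.
Qed.

Lemma Rintegral_expR_le (c t : R) : 0 < c -> 0 <= t ->
  \int[lebT]_(s in `]0, t[) expR (c * s) <= c^-1 * expR (c * t).
Proof.
move=> c0; rewrite le_eqVlt => /predU1P[<-|t0].
  by rewrite set_itvoo0 Rintegral_set0 mulr_ge0 ?expR_ge0// invr_ge0 ltW.
pose F (s : R) := c^-1 * expR (c * s).
have dF (x : R) : is_derive x 1 F (expR (c * x)).
  rewrite /F; apply: is_derive_eq.
  by rewrite /GRing.scale/= mulr1 mulrC -mulrA mulfV ?mulr1// gt_eqF.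
have cF : continuous F.
  move=> x; apply/differentiable_continuous/derivable1_diffP.
  by have [] := dF x.
have me : measurable_fun `]0, t[ (fun s => (expR (c * s))%:E).
  exact: (measurable_int lebT (expR_itv_integrable c t)).
rewrite /Rintegral -(integral_itv_bndoo true false me).
rewrite (@continuous_FTC2 _ (fun s => expR (c * s)) F)//.
- by rewrite -EFinB/= lerBlDr lerDl /F mulr_ge0 ?expR_ge0// invr_ge0 ltW.
- apply: continuous_subspaceT => x.
  apply: (@continuous_comp _ _ _ (fun s => c * s) expR).
    exact: mulrl_continuous.
  exact: continuous_expR.
- split.
  + by move=> x _; have [] := dF x.
  + exact/cvg_at_right_filter/cF.
  + exact/cvg_at_left_filter/cF.
- by move=> x _; rewrite derive1E; have [_ ->] := dF x.
Qed.

(** The hypothesis says that a bound of m by an exponential weight C e^(ct)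
    improves to L times the integral bound C e^(ct) / c of that weight. For an
    integrable m it follows from m t <= L * \int_0^t m, but it can be checked
    without knowing that m is measurable. *)
Lemma exp_weight_gronwall (m : R -> R) (B L T : R) : 0 <= L ->
  (forall t, t \in `[0, T] -> m t <= B) ->
  (forall C c : R, 0 <= C -> 0 < c ->
    (forall s, s \in `[0, T] -> m s <= C * expR (c * s)) ->
    forall t, t \in `[0, T] -> m t <= L * (C * (c^-1 * expR (c * t)))) ->
  forall t, t \in `[0, T] -> m t <= 0.
Proof.
move=> L0 mB step t tT.
(* With this rate L / c <= 1 / 2: each use of the hypothesis halves C. *)
pose c := 2 * L + 1.
have c0 : 0 < c by rewrite /c; lra.
have halve n : forall s, s \in `[0, T] -> m s <= `|B| / 2 ^+ n * expR (c * s).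
  elim: n => [|n ih] s sT.
    rewrite expr0 divr1 (le_trans (mB s sT))// (le_trans (ler_norm _))//.
    rewrite ler_peMr// -expR0 ler_expR; apply: mulr_ge0; first exact: ltW.
    by move: sT; rewrite in_itv/= => /andP[].
  apply: (le_trans (step _ _ _ c0 ih s sT)).
    by rewrite divr_ge0// exprn_ge0.
  set K := `|B| / 2 ^+ n.
  have K0 : 0 <= K * expR (c * s).
    by rewrite mulr_ge0 ?expR_ge0// divr_ge0// exprn_ge0.
  rewrite (_ : L * _ = L / c * (K * expR (c * s))); last by ring.
  rewrite (_ : `|B| / _ * _ = 2^-1 * (K * expR (c * s))); last first.
    by rewrite /K exprSr invfM; ring.
  by rewrite ler_wpM2r// ler_pdivrMr// /c; lra.
have h0 : (fun n => `|B| / 2 ^+ n * expR (c * t)) @ \oo --> (0 : R).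
  have -> : (0 : R) = `|B| * 0 * expR (c * t) by rewrite mulr0 mul0r.
  apply: cvgMr_tmp; apply: cvgMl_tmp.
  under eq_fun do rewrite -exprVn.
  by apply: cvg_expr; rewrite ger0_norm ?invr_ge0// invf_lt1// ltr1n.
have := cvg_lim (@Rhausdorff R) h0 => <-.
apply: limr_ge; first by apply/cvg_ex; exists 0.
by apply: nearW => n; exact: halve.
Qed.

End exponential_gronwall.

(** * Boundedness in time of L^2-continuous functions *)

Section L2_bounded.
Context (R : realType) (d : nat) (Y : set 'rV[R]_d) (T : R).
Hypothesis mY : measurable Y.
Hypothesis Yfin : (lebesgue_rV R d Y < +oo)%E.
Local Notation lebY := (lebesgue_rV R d).

(** The L^1(Y) norms of the values are bounded: near each time t they exceed the
    norm at t by at most the measure of Y plus 1, and [0, T] is compact. *)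
Lemma continuous_L2_bounded (g : 'rV[R]_d -> R -> R) : continuous_L2 Y T g ->
  exists B : R, forall t, t \in `[0, T] ->
    \int[lebY]_(y in Y) `|g y t| <= B.
Proof.
move=> [mg gL gc].
have ig t : t \in `[0, T] -> lebY.-integrable Y (EFin \o g ^~ t).
  by move=> tT; apply: Lp_on_2_integrable => //; exact: gL.
pose P (B t : R) := t \in `[0, T] -> \int[lebY]_(y in Y) `|g y t| <= B.
have := (compact_near_coveringP _).1 (@segment_compact R 0 T).
move=> /near_covering_withinP /(_ R (+oo%R : set_system R) P _) h.
have {h}[|B0 [_ /(_ (B0 + 1))]] := h.
  move=> t tT.
  have N1 : \forall s \near within `[0, T]%classic (nbhs t),
      (Lnorm lebY 2%:E (EFin \o ((fun y => (g y s - g y t)%R) \_ Y)) < 1)%E.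
    apply: (gc t tT [set e | (e < 1)%E]); apply: open_nbhs_nbhs.
    split; last exact: lte01.
    exact: open_ereal_lt_ereal.
  pose K := \int[lebY]_(y in Y) `|g y t| + (fine (lebY Y) + 1).
  exists ([set s | s \in `[0, T] ->
      (Lnorm lebY 2%:E (EFin \o ((fun y => (g y s - g y t)%R) \_ Y)) < 1)%E],
      [set r | K <= r]) => /=.
    by split; [exact: N1|by apply: nbhs_pinfty_ge; rewrite num_real].
  move=> [s r] [/= sN Kr] sT _.
  have md : measurable_fun Y (fun y => g y s - g y t).
    have /measurable_EFinP m1 := measurable_int lebY (ig s sT).
    have /measurable_EFinP m2 := measurable_int lebY (ig t tT).
    exact: measurable_funB.
  have [id dle] := Lnorm2_le1 mY Yfin md (ltW (sN sT)).
  apply: le_trans Kr; rewrite /K.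
  apply: (@le_trans _ _ (\int[lebY]_(y in Y) (`|g y t| + `|g y s - g y t|))).
    apply: le_Rintegral => //.
    - by apply: integrable_norm; exact: ig.
    - exact: (integrableD mY (integrable_norm (ig t tT)) (integrable_norm id)).
    - move=> y _; rewrite (le_trans _ (ler_normD _ _))//.
      by rewrite addrC subrK.
  rewrite RintegralD//; last 2 first.
  - by apply: integrable_norm; exact: ig.
  - exact: integrable_norm.
  rewrite lerD2l /Rintegral -lee_fin fineK; last first.
    by apply: integrable_fin_num => //; exact: (integrable_norm id).
  by rewrite EFinD fineK// ge0_fin_numE.
move=> hB; exists (B0 + 1) => t tT.
by apply: hB => //; rewrite ltrDl.
Qed.

End L2_bounded.

(** * Sections and cylinders in product spaces *)

Section sections.
Context d1 d2 (X : measurableType d1) (Z : measurableType d2) (R : realType).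

Lemma measurable_fun_xsection_on (A : set X) (B : set Z) (F : X * Z -> R) x :
  measurable A -> measurable B -> measurable_fun (A `*` B) F -> A x ->
  measurable_fun B (fun z => F (x, z)).
Proof.
move=> mA mB mF Ax.
apply: (@measurable_comp _ _ _ _ _ _ (A `*` B) F _ (fun z => (x, z))) => //.
- exact: measurableX.
- by move=> _ [z Bz <-].
- by apply: measurable_funTS; apply: measurable_fun_pair.
Qed.

Lemma measurable_fun_ysection_on (A : set X) (B : set Z) (F : X * Z -> R) z :
  measurable A -> measurable B -> measurable_fun (A `*` B) F -> B z ->
  measurable_fun A (fun x => F (x, z)).
Proof.
move=> mA mB mF Bz.
apply: (@measurable_comp _ _ _ _ _ _ (A `*` B) F _ (fun x => (x, z))) => //.
- exact: measurableX.
- by move=> _ [x Ax <-].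
- by apply: measurable_funTS; apply: measurable_fun_pair.
Qed.

Lemma measurable_fun_fst_on (A : set X) (B : set Z) (u : X -> R) :
  measurable A -> measurable B -> measurable_fun A u ->
  measurable_fun (A `*` B) (fun p => u p.1).
Proof.
move=> mA mB mfu.
apply: (@measurable_comp _ _ _ _ _ _ A u _ fst) => //.
- by move=> _ [p [Ap _] <-].
- by apply: measurable_funTS; exact: measurable_fst.
Qed.

Variables (m1 : {sigma_finite_measure set X -> \bar R}).
Variables (m2 : {sigma_finite_measure set Z -> \bar R}).

Lemma ae_snd (P : Z -> Prop) : {ae m2, forall z, P z} ->
  {ae (m1 \x m2)%E, forall p, P p.2}.
Proof.
move=> [N [mN N0 PN]]; exists (setT `*` N); split.
- exact: measurableX.
- by rewrite product_measure1E// N0 mule0.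
- by move=> [x z] /= nP; split => //; exact: PN.
Qed.

Lemma Lp_on_2_fst (A : set X) (B : set Z) (u : X -> R) :
  measurable A -> measurable B -> (m2 B < +oo)%E ->
  Lp_on m1 A 2%:E u -> Lp_on (m1 \x m2)%E (A `*` B) 2%:E (fun p => u p.1).
Proof.
move=> mA mB Bfin /(Lp_on_2P _ mA)[mfu iu].
have mAB : measurable (A `*` B) by exact: measurableX.
apply/Lp_on_2P => //; split; first exact: measurable_fun_fst_on.
have mfu2 : measurable_fun A (fun x => u x ^+ 2) by exact: measurable_funX.
have mv : measurable_fun (A `*` B) (EFin \o (fun p => u p.1 ^+ 2)).
  by apply/measurable_EFinP; exact: (measurable_fun_fst_on mA mB mfu2).
apply/integrable_mkcond => //; apply/integrable12ltyP.
  exact: (measurable_restrictT _ mAB).1.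
move/integrableP : iu => [_ ioo].
apply: (@le_lt_trans _ _ (\int[m1]_x
    ((fun x => m2 B * (u x ^+ 2)%:E)%E \_ A) x)%E); last first.
  rewrite -integral_mkcond ge0_integralZl//; last 2 first.
  - by apply/measurable_EFinP.
  - by move=> x _; rewrite lee_fin sqr_ge0.
  rewrite lte_mul_pinfty// ?ge0_fin_numE//.
  apply: le_lt_trans ioo; rewrite le_eqVlt; apply/orP; left; apply/eqP.
  by apply: eq_integral => x _ /=; rewrite ger0_norm ?sqr_ge0.
rewrite le_eqVlt; apply/orP; left; apply/eqP; apply: eq_integral => x _.
rewrite patchE; case: ifPn => [|xA].
  rewrite inE => Ax.
  rewrite (eq_integral ((cst (u x ^+ 2)%:E) \_ B)%E).
    by rewrite -integral_mkcond integral_cst// muleC.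
  move=> z _; rewrite [RHS]patchE; case: ifPn => [zB|zB]; rewrite patchE.
    have Bz := set_mem zB.
    by rewrite mem_set//= ger0_norm ?sqr_ge0.
  rewrite ifF ?abse0//; apply/negbTE; apply: contra zB.
  by move=> /set_mem[_ Bz]; exact: mem_set.
rewrite integral0_eq// => z _; rewrite patchE ifF ?abse0//.
by apply/negbTE; apply: contra xA => /set_mem[Ax _]; exact: mem_set.
Qed.

End sections.

(** * Positivity of the derivative *)

Section derivative_positivity.
Context (R : realType) (s' : R -> R).
Hypothesis s'_inf :
  forall r : R, 0 < r -> 0 < inf [set s' x | x in [set x : R | `|x| <= r]].

Lemma ge_inf_ball r x : 0 < r -> `|x| <= r ->
  inf [set s' x | x in [set x : R | `|x| <= r]] <= s' x.
Proof.
move=> r0 xr; set A := [set _ | _ in _].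
(* The infimum of a set that is not bounded below is 0 by convention, which the
   positivity hypothesis excludes. *)
have [Ainf|Ainf] := pselect (has_inf A).
  by apply: ge_inf; [exact: Ainf.2|exists x].
by have := s'_inf r0; rewrite -/A inf_out// ltxx.
Qed.

Lemma inf_ball_gt0_pointwise x : 0 < s' x.
Proof.
have r0 : 0 < `|x| + 1 by rewrite ltr_wpDl.
by apply: lt_le_trans (s'_inf r0) (ge_inf_ball r0 _); rewrite lerDl.
Qed.

End derivative_positivity.

(** * The affine path from the initial state to the target *)

Section linear_interpolation.
Context (R : realType) (d : nat) (Y : set 'rV[R]_d) (T : R).
Hypothesis mY : measurable Y.
Variables gI gT : 'rV[R]_d -> R.
Hypothesis gIL : Lp_space Y 2%:E gI.
Hypothesis gTL : Lp_space Y 2%:E gT.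
Local Notation lebY := (lebesgue_rV R d).

(** The path t |-> (1 - t/T) gI + (t/T) gT in L^2(Y). *)
Definition interpolation (y : 'rV[R]_d) (t : R) : R :=
  (1 - t / T) * gI y + t / T * gT y.

Lemma interpolation_Lp t : Lp_space Y 2%:E (interpolation ^~ t).
Proof. exact: Lp_on_2_lin. Qed.

Lemma interpolation_measurable (I : set (measurableTypeR R)) : measurable I ->
  measurable_fun (Y `*` I)
    (fun x : 'rV[R]_d * measurableTypeR R => interpolation x.1 x.2).
Proof.
move=> mI.
have [mgI _] := (Lp_on_2P _ mY _).1 gIL.
have [mgT _] := (Lp_on_2P _ mY _).1 gTL.
have mt : measurable_fun (Y `*` I)
    (fun x : 'rV[R]_d * measurableTypeR R => (x.2 : R) / T).
  apply: measurable_funTS; apply: measurable_funM => //.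
apply: measurable_funD; apply: measurable_funM => //.
- exact: measurable_funB.
- exact: (measurable_fun_fst_on mY mI mgI).
- exact: (measurable_fun_fst_on mY mI mgT).
Qed.

Lemma interpolation_continuous_L2 : continuous_L2 Y T interpolation.
Proof.
split; first exact: interpolation_measurable.
  by move=> t _; exact: interpolation_Lp.
move=> t _; apply: cvg_within_filter.
have dL : Lp_space Y 2%:E (fun y => -1 * gI y + 1 * gT y) by exact: Lp_on_2_lin.
have p1 : (1 <= 2%:E :> \bar R)%E by rewrite lee_fin ler1n.
pose dgL := Lfun_Sub p1 dL.
pose N := fine (Lnorm lebY 2%:E (EFin \o dgL)).
have NE : (Lnorm lebY 2%:E (EFin \o dgL) = N%:E)%E.
  by rewrite /N fineK// ge0_fin_numE// ?Lnorm_ge0//; exact: Lfunction_finite.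
rewrite (_ : (fun s => _) = EFin \o (fun s => `|(s - t) / T| * N)).
  apply: cvg_EFin; first by apply: nearW.
  have -> : (0 : R) = `|(t - t) / T| * N by rewrite subrr mul0r normr0 mul0r.
  apply: cvgMr_tmp; apply: cvg_norm; apply: cvgMr_tmp.
  by apply: cvgB => //; exact: cvg_cst.
apply/funext => s /=; rewrite EFinM -NE -LnormZ; congr Lnorm.
apply/funext => y /=; rewrite !patchE; case: ifPn => _ /=.
  by congr EFin; rewrite /interpolation /GRing.scale/=; ring.
by rewrite scaler0.
Qed.

End linear_interpolation.

(** * The steering control and the solutions it produces *)

Section controllability.
Context (R : realType) (d : nat) (Y : set 'rV[R]_d) (T : R).
Variables (sigma : R -> R) (f a : 'rV[R]_d -> R -> R).
Variable b : 'rV[R]_d -> 'rV[R]_d -> R -> R.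
Hypothesis mY : measurable Y.
Hypothesis Yfin : (lebesgue_rV R d Y < +oo)%E.
Hypothesis T0 : 0 < T.
Hypothesis sigmaC1 : continuous (derive1 sigma).
Hypothesis fL : Lp_space_time Y T +oo%E f.
Hypothesis aL : Lp_space_time Y T +oo%E a.
Hypothesis bL : Lp_kernel Y T +oo%E b.
Variable K : R.
Hypothesis sigmaK : forall x, derive1 sigma x <= K.
Hypothesis sigma_inf : forall r : R, 0 < r ->
  0 < inf [set derive1 sigma x | x in [set x : R | `|x| <= r]].
Local Notation lebY := (lebesgue_rV R d).
Local Notation lebT := (@lebesgue_measure R).
Local Notation time := (measurableTypeR R).
Local Notation D := (Y `*` `]0, T[%classic : set ('rV[R]_d * time)).
Local Notation S y t := (derive1 sigma (xi Y a b f y t)).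

Let mD : measurable D. Proof. exact: measurableX. Qed.

Let Dfin : ((lebY \x lebT)%E D < +oo)%E.
Proof.
rewrite product_measure1E// [X in (_ * X)%E](_ : _ = T%:E).
  by rewrite lte_mul_pinfty// ?ge0_fin_numE// ltry.
by rewrite [LHS]lebesgue_measure_itv/= lte_fin T0 oppr0 adde0.
Qed.

Let mb : measurable_fun ((Y `*` Y) `*` `]0, T[%classic)
  (fun x : ('rV[R]_d * 'rV[R]_d) * time => b x.1.1 x.1.2 x.2).
Proof.
have mD3 : measurable ((Y `*` Y) `*` `]0, T[%classic :
    set (('rV[R]_d * 'rV[R]_d) * time)).
  by apply: measurableX => //; exact: measurableX.
by have [] := Lp_on_pinftyP mD3 bL.
Qed.

Let mf : measurable_fun D (fun x => f x.1 x.2).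
Proof. by have [] := Lp_on_pinftyP mD fL. Qed.

Lemma measurable_xi : measurable_fun D (fun x => xi Y a b f x.1 x.2).
Proof.
apply: measurable_funB; first by have [] := Lp_on_pinftyP mD aL.
exact: measurable_kernel_op.
Qed.

Lemma measurable_sigma_xi : measurable_fun D (fun x => S x.1 x.2).
Proof.
apply: measurableT_comp measurable_xi.
exact: continuous_measurable_fun.
Qed.

Lemma sigma_gt0 x : 0 < derive1 sigma x.
Proof. exact: inf_ball_gt0_pointwise. Qed.

Lemma xi_bounded : exists2 r : R, 0 < r &
  {ae (lebY \x lebT)%E, forall x, D x -> `|xi Y a b f x.1 x.2| <= r}.
Proof.
have [_ [A A0 aA]] := Lp_on_pinftyP mD aL.
have [_ [F F0 fF]] := Lp_on_pinftyP mD fL.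
have [M M0 bM] := kernel_op_bound mY bL.
exists (A + M * (F * fine (lebY Y)) + 1).
  by rewrite ltr_wpDl// addr_ge0// !mulr_ge0// fine_ge0.
have := ae_snd lebY (ae_product2 fF).
apply: filterS3 aA bM => -[y t] /= ax bx fx Dyt; have [Yy tT] := Dyt.
have Fz : {ae lebY, forall z, Y z -> `|f z t| <= F}.
  by apply: filterS fx => z + Yz; exact.
have mft : measurable_fun Y (f ^~ t).
  exact: (measurable_fun_ysection_on mY _ mf tT).
have ift : lebY.-integrable Y (EFin \o f ^~ t).
  exact: (integrable_le_ae mY mft Fz (integrable_cst_on mY Yfin F)).
have [_ Bb] := bx Dyt _ ift.
rewrite (le_trans (ler_normB _ _))// -addrA lerD ?ax//.
rewrite ler_wpDr// (le_trans Bb)// ler_wpM2l//.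
rewrite -Rintegral_cst//; apply: le_trans (ler_norm _) _.
apply: normr_Rintegral_le_ae => //.
- exact: measurableT_comp.
- by apply: filterS Fz => z; rewrite normr_id.
- exact: integrable_cst_on.
Qed.

(** This is what makes the quotient by sigma' (xi) in the steering control below
    a function of class L^2. *)
Lemma sigma_xi_lower : exists2 k : R, 0 < k &
  {ae (lebY \x lebT)%E, forall x, D x -> k <= S x.1 x.2}.
Proof.
have [r r0 xr] := xi_bounded.
exists (inf [set derive1 sigma x | x in [set x : R | `|x| <= r]]).
  exact: sigma_inf.
by apply: filterS xr => x /[apply]; exact: ge_inf_ball.
Qed.

Lemma kernel_op0 phi y t : kernel_op Y (fun _ _ _ => 0) phi y t = 0 :> R.
Proof.
rewrite /kernel_op /Rintegral integral0_eq// => z _; by rewrite mul0r.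
Qed.

Variables gI gT : 'rV[R]_d -> R.
Hypothesis gIL : Lp_space Y 2%:E gI.
Hypothesis gTL : Lp_space Y 2%:E gT.
Local Notation gbar := (interpolation T gI gT).
Local Notation L1norm u := (\int[lebY]_(y in Y) `|u y|).

(** The control alpha for which, with beta = 0, the right-hand side of the
    linearized equation along the affine path is the constant velocity
    (gT - gI) / T: it cancels B_b and divides the velocity by sigma' (xi). *)
Definition steering_control (y : 'rV[R]_d) (t : R) : R :=
  kernel_op Y b gbar y t + (gT y - gI y) / (T * S y t).
Local Notation alpha := steering_control.
Local Notation beta0 := (fun _ _ _ => 0 : R).

Let mgbarD : measurable_fun D (fun x => gbar x.1 x.2).
Proof. exact: interpolation_measurable. Qed.

Let dgL : Lp_space Y 2%:E (fun y => gT y - gI y).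
Proof.
rewrite (_ : (fun _ => _) = (fun y => 1 * gT y + (-1) * gI y)).
  exact: Lp_on_2_lin.
by apply/funext => y; ring.
Qed.

Lemma measurable_steering_control : measurable_fun D (fun x => alpha x.1 x.2).
Proof.
apply: measurable_funD; first exact: measurable_kernel_op.
apply: measurable_funM.
  have [mdg _] := (Lp_on_2P _ mY _).1 dgL.
  exact: (measurable_fun_fst_on mY _ mdg).
rewrite (_ : (fun _ => _) = (fun x => (T * S x.1 x.2) `^ (-1))).
  apply: (@measurableT_comp _ _ _ _ _ _ (@powR R ^~ (-1))).
    exact: measurable_powR.
  by apply: measurable_funM => //; exact: measurable_sigma_xi.
by apply/funext => x; rewrite powR_inv1// mulr_ge0 ?ltW// sigma_gt0.
Qed.

Lemma steering_control_Lp : Lp_space_time Y T 2%:E alpha.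
Proof.
have [M M0 bM] := kernel_op_bound mY bL.
have [k k0 Sk] := sigma_xi_lower.
have igI := Lp_on_2_integrable mY Yfin gIL.
have igT := Lp_on_2_integrable mY Yfin gTL.
(* |alpha| <= M (|gI|_1 + |gT|_1) + |gT - gI| / (T k), where k bounds
   sigma' (xi) from below. *)
pose c := (T * k)^-1; pose v y := c * gT y + - c * gI y.
apply: (@Lp_on_2_le_ae _ _ _ _ _ mD Dfin _ (fun x => `|v x.1|)
  (M * (L1norm gI + L1norm gT))).
- exact: measurable_steering_control.
- apply: filterS2 bM Sk => -[y t] /= bx Sx Dyt; have [Yy tT] := Dyt.
  have [_ Bb] := bx Dyt _ (Lp_on_2_integrable mY Yfin
    (interpolation_Lp T mY gIL gTL t)).
  rewrite (le_trans (ler_normD _ _))// lerD//.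
    rewrite (le_trans Bb)// ler_wpM2l// -RintegralD//; last 2 first.
    + exact: integrable_norm.
    + exact: integrable_norm.
    move: tT; rewrite in_itv/= => /andP[t0 tT].
    have tT0 : 0 <= t / T by rewrite divr_ge0// ltW.
    have tT1 : t / T <= 1 by rewrite ler_pdivrMr// mul1r ltW.
    apply: le_Rintegral => //.
    + apply: integrable_norm; apply: Lp_on_2_integrable => //.
      exact: interpolation_Lp.
    + exact: (integrableD mY (integrable_norm igI) (integrable_norm igT)).
    + move=> z _; rewrite (le_trans (ler_normD _ _))// !normrM lerD//.
        by rewrite ler_piMl// ger0_norm ?subr_ge0// gerBl.
      by rewrite -normrM ler_piMl// ger0_norm.
  rewrite /v mulNr -mulrBr mulrC !normrM ler_wpM2r// /c.
  have S0 : 0 < T * S y t by rewrite mulr_gt0// sigma_gt0.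
  have k0' : 0 < T * k by rewrite mulr_gt0.
  rewrite !gtr0_norm ?invr_gt0//.
  by rewrite lef_pV2 ?posrE ?mulr_gt0 ?sigma_gt0// ler_pM2l// Sx.
- have vL : Lp_space Y 2%:E v by exact: Lp_on_2_lin.
  have mI : measurable (`]0, T[%classic : set time) by [].
  have [_ iv] := (Lp_on_2P _ mD _).1
    (Lp_on_2_fst mY mI (lebesgue_itvoo_lty T) vL).
  rewrite (_ : (fun x => _) = (fun x => v x.1 ^+ 2))//.
  by apply/funext => x; rewrite real_normK ?num_real.
Qed.

Lemma linearized_rhs_interpolation y s :
  linearized_rhs Y sigma f a b alpha beta0 gbar y s = (gT y - gI y) / T.
Proof.
have S0 := sigma_gt0 (xi Y a b f y s).
rewrite /linearized_rhs kernel_op0 subr0 /steering_control.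
by field; rewrite !gt_eqF.
Qed.

Lemma interpolation_solution :
  linearized_solution Y T sigma f a b alpha beta0 gI gbar.
Proof.
split; first exact: interpolation_continuous_L2.
  by apply: aeW => y _; rewrite /interpolation mul0r subr0 mul1r mul0r addr0.
move=> t; rewrite in_itv/= => /andP[t0 tT]; apply: aeW => y _.
under eq_Rintegral do rewrite linearized_rhs_interpolation.
rewrite Rintegral_cst// fine_lebesgue_itvoo//.
by rewrite /interpolation; field; rewrite gt_eqF.
Qed.


(** * Every solution follows the affine path *)

Section uniqueness.
Variable g : 'rV[R]_d -> R -> R.
Hypothesis gsol : linearized_solution Y T sigma f a b alpha beta0 gI g.
Local Notation rhs :=
  (linearized_rhs Y sigma f a b alpha beta0 g).

Let gL t : t \in `[0, T] -> Lp_space Y 2%:E (g ^~ t).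
Proof. by have [[_ + _] _ _] := gsol; exact. Qed.

Let ig t : t \in `[0, T] -> lebY.-integrable Y (EFin \o g ^~ t).
Proof. by move=> tT; apply: Lp_on_2_integrable => //; exact: gL. Qed.

Let igbar t : lebY.-integrable Y (EFin \o gbar ^~ t).
Proof. by apply: Lp_on_2_integrable => //; exact: interpolation_Lp. Qed.

(** The gap between the solution g and the affine path. *)
Let h y t := g y t - gbar y t.

Let ih t : t \in `[0, T] -> lebY.-integrable Y (EFin \o h ^~ t).
Proof. by move=> tT; exact: (integrableB mY (ig tT) (igbar t)). Qed.

Lemma solution_gap_bounded :
  exists B : R, forall t, t \in `[0, T] -> L1norm (h ^~ t) <= B.
Proof.
have [gc _ _] := gsol.
have [B1 gB1] := continuous_L2_bounded mY Yfin gc.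
have [B2 gB2] := continuous_L2_bounded mY Yfin
  (interpolation_continuous_L2 T mY gIL gTL).
exists (B1 + B2) => t tT; apply: le_trans (lerD (gB1 t tT) (gB2 t tT)).
rewrite -RintegralD//; last 2 first.
- by apply: integrable_norm; exact: ig.
- by apply: integrable_norm; exact: igbar.
apply: le_Rintegral => //.
- by apply: integrable_norm; exact: ih.
- exact: (integrableD mY (integrable_norm (ig tT)) (integrable_norm (igbar t))).
- by move=> y _; exact: ler_normB.
Qed.

Lemma measurable_linearized_rhs : measurable_fun D (fun x => rhs x.1 x.2).
Proof.
have [[mg _ _] _ _] := gsol.
have mgD : measurable_fun D (fun x => g x.1 x.2).
  apply: measurable_funS mg; first exact: measurableX.
  by move=> [y t] [/= Yy tT]; split => //=; exact: subset_itv_oo_cc.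
have mS := measurable_sigma_xi.
apply: measurable_funD; apply: measurable_funM => //.
- exact: measurable_funN.
- exact: measurable_kernel_op.
- apply: measurable_funB; first exact: measurable_steering_control.
  rewrite (_ : (fun _ => _) = cst 0); first exact: measurable_cst.
  by apply/funext => x; exact: kernel_op0.
Qed.

(** The difference of the right-hand sides along g and along the affine path is
    - sigma' (xi) B_b h, since the contribution of the control cancels. *)
Lemma linearized_rhs_gap : exists2 M : R, 0 <= M &
  {ae (lebY \x lebT)%E, forall x, D x ->
    `|rhs x.1 x.2 - (gT x.1 - gI x.1) / T| <= M * L1norm (h ^~ x.2)}.
Proof.
have [M M0 bM] := kernel_op_bound mY bL.
have K0 : 0 <= K by apply: le_trans (sigmaK 0); exact: ltW (sigma_gt0 _).
exists (K * M); first exact: mulr_ge0.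
apply: filterS bM => -[y t] /= bx Dyt; have [_ /= tT] := Dyt.
have tT' : t \in `[0, T] by exact: subset_itv_oo_cc.
have [ib1 _] := bx Dyt _ (ig tT'); have [ib2 _] := bx Dyt _ (igbar t).
have [_ hM] := bx Dyt _ (ih tT').
have -> : rhs y t - (gT y - gI y) / T =
    - (S y t * \int[lebY]_(z in Y) (b y z t * h z t)).
  rewrite (_ : \int[lebY]_(z in Y) (b y z t * h z t) =
      kernel_op Y b g y t - kernel_op Y b gbar y t); last first.
    rewrite /kernel_op -RintegralB//.
    by apply: eq_Rintegral => z _; rewrite /h mulrBr.
  have S0 := sigma_gt0 (xi Y a b f y t).
  rewrite /linearized_rhs kernel_op0 subr0 /steering_control.
  by field; rewrite !gt_eqF.
rewrite normrN normrM -mulrA ler_pM//.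
by rewrite gtr0_norm// sigma_gt0.
Qed.

(** Integrating the previous bound over (0, t), for almost every y, and then
    over Y gives the hypothesis of [exp_weight_gronwall] for the L^1(Y) norm of
    the gap h. *)
Lemma solution_gap_gronwall : exists2 L : R, 0 <= L &
  forall C c : R, 0 <= C -> 0 < c ->
    (forall s, s \in `[0, T] -> L1norm (h ^~ s) <= C * expR (c * s)) ->
  forall t, t \in `[0, T] ->
    L1norm (h ^~ t) <= L * (C * (c^-1 * expR (c * t))).
Proof.
have [M M0 rM] := linearized_rhs_gap.
exists (M * fine (lebY Y)); first by rewrite mulr_ge0// fine_ge0.
move=> C c C0 c0 hC t tT.
have [_ g0 gt] := gsol.
have t0 : 0 <= t by move: tT; rewrite in_itv/= => /andP[].
have tT' : t <= T by move: tT; rewrite in_itv/= => /andP[].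
have tsub : `]0, t[%classic `<=` (`]0, T[%classic : set time).
  by apply: subset_itvl; rewrite bnd_simp.
have iexp : lebT.-integrable `]0, t[
    (EFin \o (fun s => M * C * expR (c * s))).
  exact: (integrableZl _ (M * C) (expR_itv_integrable c t)).
have hae : {ae lebY, forall y, Y y ->
    `|h y t| <= M * (C * (c^-1 * expR (c * t)))}.
  apply: filterS3 (ae_product1 rM) g0 (gt t tT) => y yM gy0 gyt Yy.
  have mr : measurable_fun `]0, t[%classic (fun s : time => rhs y s).
    apply: (@measurable_funS _ _ _ _ `]0, T[%classic) => //.
    exact: (measurable_fun_xsection_on mY _ measurable_linearized_rhs Yy).
  pose k s := rhs y s - (gT y - gI y) / T.
  have mk : measurable_fun `]0, t[%classic (k : time -> R).
    by apply: measurable_funB.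
  have kM : {ae lebT, forall s, (`]0, t[%classic : set time) s ->
      `|k s| <= M * C * expR (c * s)}.
    apply: filterS yM => s /= sM st.
    have sT := tsub _ st.
    rewrite (le_trans (sM _))// -mulrA ler_wpM2l// hC//.
    exact: subset_itv_oo_cc.
  have mI : measurable (`]0, t[%classic : set time) by [].
  have ik : lebT.-integrable `]0, t[ (EFin \o k).
    exact: (@integrable_le_ae _ time R lebT `]0, t[%classic mI k
      (fun s => M * C * expR (c * s)) mk kM iexp).
  have -> : h y t = \int[lebT]_(s in `]0, t[) k s.
    rewrite /h (gyt Yy) (gy0 Yy).
    rewrite (_ : \int[lebT]_(s in `]0, t[) rhs y s =
      \int[lebT]_(s in `]0, t[) (k s + (gT y - gI y) / T)); last first.
      by apply: eq_Rintegral => s _; rewrite /k subrK.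
    rewrite RintegralD//; last first.
      exact: (integrable_cst_on _ (lebesgue_itvoo_lty t)).
    rewrite Rintegral_cst// fine_lebesgue_itvoo// /interpolation.
    by field; rewrite gt_eqF.
  apply: (@le_trans _ _ (\int[lebT]_(s in `]0, t[) (M * C * expR (c * s)))).
    apply: (@normr_Rintegral_le_ae _ time R lebT `]0, t[%classic mI k
      (fun s => M * C * expR (c * s)) mk _ kM iexp) => s _.
    by rewrite !mulr_ge0// expR_ge0.
  rewrite RintegralZl//; last exact: expR_itv_integrable.
  by rewrite [leRHS]mulrA ler_wpM2l ?mulr_ge0// Rintegral_expR_le.
set W := C * _ in hae *.
have W0 : 0 <= W by rewrite !mulr_ge0 ?expR_ge0// invr_ge0 ltW.
rewrite mulrAC -Rintegral_cst//; apply: le_trans (ler_norm _) _.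
apply: normr_Rintegral_le_ae => //.
- apply: measurableT_comp => //.
  by have /measurable_EFinP := measurable_int lebY (ih tT).
- by move=> y _; rewrite mulr_ge0.
- by apply: filterS hae => y; rewrite normr_id.
- exact: integrable_cst_on.
Qed.

Lemma solution_reaches_target : {ae lebY, forall y, Y y -> g y T = gT y}.
Proof.
have [B hB] := solution_gap_bounded.
have [L L0 hL] := solution_gap_gronwall.
have TT : T \in `[0, T] by rewrite in_itv/= lexx ltW.
have hT := exp_weight_gronwall L0 hB hL TT.
have mh : measurable_fun Y (EFin \o h ^~ T).
  exact: (measurable_int lebY (ih TT)).
have : (\int[lebY]_(y in Y) `|(EFin \o h ^~ T) y| = 0)%E.
  have /fineK <- : (\int[lebY]_(y in Y) `|(EFin \o h ^~ T) y|)%E \is a fin_num.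
    by apply: integrable_fin_num => //; exact: (integrable_norm (ih TT)).
  congr EFin; apply/eqP; rewrite eq_le; apply/andP; split; first exact: hT.
  by apply: fine_ge0; exact: integral_ge0.
move/(ae_eq_integral_abs lebY mY mh); apply: filterS => y /= /[apply].
move=> [] /eqP; rewrite /h subr_eq0 => /eqP ->.
by rewrite /interpolation mulfV ?gt_eqF// subrr mul0r mul1r add0r.
Qed.

End uniqueness.

End controllability.

Theorem proposition5 (R : realType) (d : nat) (Y : set 'rV[R]_d) (T : R)
    (sigma : R -> R) (f a : 'rV[R]_d -> R -> R)
    (b : 'rV[R]_d -> 'rV[R]_d -> R -> R) :
  open Y -> bounded_set Y -> 0 < T ->
  (forall x, derivable sigma x 1) -> continuous (derive1 sigma) ->
  Lp_space_time Y T +oo%E f -> Lp_space_time Y T +oo%E a ->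
  Lp_kernel Y T +oo%E b ->
  forward_trajectory Y T sigma f a b ->
  has_ubound (range (derive1 sigma)) ->
  (forall r, 0 < r -> 0 < inf [set derive1 sigma x | x in [set x : R | `|x| <= r]]) ->
  linearized_controllable Y T sigma f a b.
Proof.
move=> oY bY T0 _ sigmaC1 fL aL bL _ [K sigmaK] sigma_inf gI gT gIL gTL.
have mY : measurable Y := rV_open_measurable oY.
have Yfin := lebesgue_rV_bounded mY bY.
exists (steering_control Y T sigma f a b gI gT), (fun _ _ _ => 0); split.
- exact: steering_control_Lp.
- rewrite /Lp_kernel.
  have mD3 : measurable ((Y `*` Y) `*` `]0, T[%classic :
      set (('rV[R]_d * 'rV[R]_d) * measurableTypeR R)).
    by apply: measurableX => //; exact: measurableX.
  apply/Lp_on_2P => //; split; first exact: measurable_cst.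
  rewrite (_ : _ \o _ = cst 0%E); first exact: integrable0.
  by apply/funext => x /=; rewrite expr0n.
- by exists (interpolation T gI gT); exact: interpolation_solution.
- move=> g gsol; apply: (solution_reaches_target mY Yfin T0 sigmaC1 fL aL bL _
    sigma_inf gIL gTL gsol (K := K)).
  by move=> x; apply: sigmaK; exists x.
Qed.
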